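(* Let $\ell$ be a positive integer with $\ell<6$. Then there exists no graph $G$ with an edge $e\in E(G)$ such that $\gamma_g'(G)=\ell$ and $\gamma_g'(G-e)=\ell-2$.
   Context: Graphs are finite, simple and undirected. A vertex dominates itself and all its neighbors. The domination game on a graph $G$ is played by two players, Dominator and Staller, who alternately choose a vertex of $G$ such that each chosen vertex dominates at least one vertex that was not dominated by the previously chosen vertices. The game ends when all vertices of $G$ are dominated. Dominator wants the total number of chosen vertices to be as small as possible, Staller wants it to be as large as possible. Assuming both play optimally, $\gamma_g'(G)$ (the Staller-start game domination number) is the total number of vertices chosen when Staller moves first. $G-e$ denotes the graph obtained from $G$ by removing the edge $e$ (keeping all vertices). *)

(* Defs.v *)
From mathcomp Require Import all_boot.

Set Implicit Arguments.
Unset Strict Implicit.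
Unset Printing Implicit Defensive.

Record sgraph := SGraph {
  vertex :> finType;
  adj : rel vertex;
  adj_sym : symmetric adj;
  adj_irrefl : irreflexive adj }.

Section EdgeRemoval.

Variables (G : sgraph) (x y : G).

Definition del_adj : rel G :=
  fun u v => adj u v && ([set u; v] != [set x; y]).

Lemma del_adj_sym : symmetric del_adj.
Proof. by move=> u v; rewrite /del_adj adj_sym setUC. Qed.

Lemma del_adj_irrefl : irreflexive del_adj.
Proof. by move=> u; rewrite /del_adj adj_irrefl. Qed.

Definition del_edge : sgraph := SGraph del_adj_sym del_adj_irrefl.

End EdgeRemoval.

Section DominationGame.

Variable G : sgraph.

Definition cl_nbhd (v : G) : {set G} := [set u | (u == v) || adj v u].

Definition legal (D : {set G}) (v : G) : bool := ~~ (cl_nbhd v \subset D).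

Inductive player := Dominator | Staller.

Definition opponent (p : player) : player :=
  if p is Dominator then Staller else Dominator.

(* Number of moves still to be played under optimal play when [D] is the set
   of vertices dominated so far and [p] is to move. The first argument is fuel:
   a legal move enlarges [D], so any fuel >= #|~: D| gives the true value.
   Then no value exceeds #|G|, and an undominated vertex is itself a legal
   move, so the default #|G| of the minimum never affects the result. *)
Fixpoint game_length (fuel : nat) (p : player) (D : {set G}) : nat :=
  if fuel is n.+1 then
    if D == [set: G] then 0
    else
      let after v := game_length n (opponent p) (D :|: cl_nbhd v) in
      (match p with
       | Dominator => \big[minn/#|G|]_(v | legal D v) after v
       | Staller => \max_(v | legal D v) after v
       end).+1
  else 0.

Definition staller_start_game_dom : nat := game_length #|G| Staller set0.

End DominationGame.

(* Main.v *)
Require Import Defs.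
From mathcomp Require Import all_boot.

Set Implicit Arguments.
Unset Strict Implicit.
Unset Printing Implicit Defensive.

(** Only two facts about [G] and [G - e] matter: they have the same vertices,
    and closed neighborhoods in [G - e] are contained in those of [G]. If
    Dominator can end the game on [G - e] within [k <= 2] further moves from a
    position where he is to move, he can end it within [k + 1] moves on [G]
    from any position with at least as many dominated vertices. For [k = 2] he
    copies his move [u] from [G - e]: afterwards, on [G - e], any legal move
    finishes. So on [G], whatever Staller answers, Dominator may choose any
    vertex [z] that is still undominated: [z] is legal on [G - e] as well, so
    it dominates everything that was left after [u]. *)

Section EndsWithin.

Variable V : finType.
Implicit Types (N M : V -> {set V}) (D E : {set V}) (p : player) (k : nat).

(* [N v] stands for the closed neighborhood of [v]: abstracting it from the
   graph lets games on [G] and on [G - e] share the type of positions. *)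
Fixpoint ends_within N k p D : Prop :=
  D = setT \/
  if k is j.+1 then
    match p with
    | Dominator =>
        exists2 v, ~~ (N v \subset D) & ends_within N j Staller (D :|: N v)
    | Staller =>
        forall v, ~~ (N v \subset D) -> ends_within N j Dominator (D :|: N v)
    end
  else False.

Lemma ends_within_full N k p : ends_within N k p setT.
Proof. by case: k => [|k]; left. Qed.

Lemma cards_undominated_lt N D v :
  ~~ (N v \subset D) -> #|~: (D :|: N v)| < #|~: D|.
Proof.
move=> /subsetPn[a aN aD]; apply/proper_card/properP; split.
  by rewrite setCS subsetUl.
by exists a; rewrite !inE ?aD // aN orbT.
Qed.

Lemma not_setT_exists D : D != setT -> exists z, z \notin D.
Proof. by rewrite -subTset => /subsetPn[z _ zD]; exists z. Qed.

(** Every legal move dominates a new vertex, so the number of undominated vertices bounds the length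
    of any play, optimal or not. *)
Lemma ends_within_card N k p D :
  (forall v, v \in N v) -> #|~: D| <= k -> ends_within N k p D.
Proof.
move=> N_refl; elim: k p D => [|k IHk] p D leDk.
  left; apply/eqP; rewrite -subTset; apply/subsetP => z _.
  move: leDk; rewrite leqn0 cards_eq0 => /eqP/setP/(_ z).
  by rewrite !inE => /negbFE.
have step v : ~~ (N v \subset D) -> #|~: (D :|: N v)| <= k.
  by move=> /cards_undominated_lt ltD; rewrite -ltnS (leq_trans ltD).
have [->|/not_setT_exists[z zD]] := eqVneq D setT.
  exact: ends_within_full.
right; case: p => [|v vD]; last exact: IHk (step v vD).
have Nz : ~~ (N z \subset D) by apply/subsetPn; exists z.
by exists z => //; apply: IHk (step z Nz).
Qed.

Lemma sub_full D E : D \subset E -> D = setT -> E = setT.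
Proof. by move=> subDE DT; apply/eqP; rewrite -subTset -DT. Qed.

Lemma Dominator_ends_within_super M N k D E :
    (forall v, v \in M v) -> (forall v, M v \subset N v) -> k <= 2 ->
    D \subset E ->
  ends_within M k Dominator D -> ends_within N k.+1 Dominator E.
Proof.
move=> M_refl subMN le_k2 subDE endsD.
have [->|] := eqVneq E setT; first exact: ends_within_full.
move=> E_neqT; have [z zE] := not_setT_exists E_neqT.
move/eqP: E_neqT => E_neqT.
have DneqT : D <> setT by move/(sub_full subDE).
have legal_in v (F : {set V}) : v \notin F -> ~~ (N v \subset F).
  by move=> vF; apply/subsetPn; exists v => //; apply: (subsetP (subMN v)).
have legal_or v : (~~ (N v \subset E)) \/ E :|: N v = E.
  by case: (boolP (N v \subset E)) => [/setUidPl|]; [right | left].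
case: k le_k2 endsD => [|[|[|//]]] _.
- by case.
(* For [k = 1], [u] finishes the game for [M], hence also for [N]; were it illegal for [N], [E]
   would already be full. *)
- case=> [//|[u _ [DuT|//]]].
  have EuT : E :|: N u = setT by apply: sub_full _ DuT; apply: setUSS.
  have [uE|uE] := legal_or u.
    by right; exists u => //; rewrite EuT; apply: ends_within_full.
  by case: E_neqT; rewrite -uE.
- case=> [//|[u _ endsDu]].
  have subDuEu : D :|: M u \subset E :|: N u by apply: setUSS.
  have undominated_finishes (F : {set V}) y :
      E :|: N u \subset F -> y \notin F -> F :|: N y = setT.
    move=> subF yF; have subDuF := subset_trans subDuEu subF.
    have yDu : y \notin D :|: M u by apply: contra yF; apply: (subsetP subDuF).
    case: endsDu => [DuT|]; first by rewrite DuT inE in yDu.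
    move=> /(_ y) []; [by apply/subsetPn; exists y | | by []].
    by apply: sub_full; apply: setUSS.
  (* If [u] is illegal for [N], then [E] already contains [N u]: Dominator skips the copied move and
     finishes with [z] at once. *)
  right; have [uE|uE] := legal_or u; last first.
    exists z; first exact: legal_in.
    by rewrite undominated_finishes ?uE //; apply: ends_within_full.
  exists u => //; right=> w _.
  have [->|/not_setT_exists[y yF]] := eqVneq (E :|: N u :|: N w) setT.
    exact: ends_within_full.
  right; exists y; first exact: legal_in.
  by rewrite undominated_finishes ?subsetUl //; apply: ends_within_full.
Qed.

(** Since [v \in M v], Staller's opening move [v] is also legal for [M]; after it Dominator is to
    move, with [M v] inside [N v]. *)
Lemma Staller_ends_within_super M N k :
    (forall v, v \in M v) -> (forall v, M v \subset N v) -> k <= 2 ->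
  ends_within M k.+1 Staller set0 -> ends_within N k.+2 Staller set0.
Proof.
move=> M_refl subMN le_k2 [emptyT|ends0]; first by left.
right=> v _.
apply: (Dominator_ends_within_super (M := M) (D := set0 :|: M v)) => //.
  exact: setUS.
by apply: ends0; apply/subsetPn; exists v; rewrite ?inE.
Qed.

End EndsWithin.

Section GameLength.

Variable G : sgraph.
Implicit Types (D : {set G}) (p : player).

Lemma cl_nbhd_refl (v : G) : v \in cl_nbhd v.
Proof. by rewrite inE eqxx. Qed.

Lemma bigmin_leP (I : finType) (P : pred I) (F : I -> nat) m k :
  \big[minn/m]_(i | P i) F i <= k -> m <= k \/ exists2 i, P i & F i <= k.
Proof.
elim/big_ind: _ => [|a b IHa IHb|i Pi leFk]; [by left | | by right; exists i].
by rewrite geq_min => /orP[/IHa|/IHb].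
Qed.

Lemma bigmin_le (I : finType) (P : pred I) (F : I -> nat) m i :
  P i -> \big[minn/m]_(j | P j) F j <= F i.
Proof.
rewrite -big_filter => Pi.
have: i \in [seq j <- index_enum I | P j].
  by rewrite mem_filter Pi mem_index_enum.
elim: [seq _ <- _ | _] => //= j s IHs; rewrite inE big_cons geq_min.
by case/predU1P => [->|/IHs->]; rewrite ?leqnn ?orbT.
Qed.

Lemma game_length_le_ends_within n k p D :
  #|~: D| <= n -> game_length n p D <= k -> ends_within (@cl_nbhd G) k p D.
Proof.
elim: n k p D => [|n IHn] k p D leDn.
  move=> _; apply: ends_within_card cl_nbhd_refl _.
  exact: leq_trans leDn (leq0n k).
have step v : legal D v -> #|~: (D :|: cl_nbhd v)| <= n.
  by move=> /cards_undominated_lt ltD; rewrite -ltnS (leq_trans ltD).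
rewrite /=; case: eqP => [-> _|_]; first exact: ends_within_full.
case: k p => [|k] [] //; rewrite ltnS.
  (* If the bound comes only from the default [#|G|] of the minimum, counting vertices suffices. *)
  case/bigmin_leP => [leGk|[v vD le_k]].
    apply: ends_within_card cl_nbhd_refl _.
    exact: leq_trans (max_card _) (leqW leGk).
  by right; exists v => //; apply: IHn le_k; apply: step.
by move=> /bigmax_leqP le_k; right=> v vD; apply: IHn (step v vD) (le_k v vD).
Qed.

(** Any fuel works in this direction: running out of it yields 0, which can only lower the value. *)
Lemma ends_within_game_length_le n k p D :
  ends_within (@cl_nbhd G) k p D -> game_length n p D <= k.
Proof.
elim: n k p D => [|n IHn] k p D //= endsD; case: eqP => // /eqP D_neqT.
case: k endsD => [|k] [DT|] //; [by rewrite DT eqxx in D_neqT.. |].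
rewrite ltnS; case: p => [[v vD /IHn le_k]|ends_after].
  by apply: leq_trans le_k; apply: bigmin_le.
by apply/bigmax_leqP => v vD; apply/IHn/ends_after.
Qed.

Lemma staller_start_game_dom_leP k :
  staller_start_game_dom G <= k <-> ends_within (@cl_nbhd G) k Staller set0.
Proof.
split; last exact: ends_within_game_length_le.
exact/game_length_le_ends_within/max_card.
Qed.

End GameLength.

Lemma cl_nbhd_del_edge (G : sgraph) (x y v : G) :
  (cl_nbhd (v : del_edge x y) : {set G}) \subset cl_nbhd v.
Proof.
apply/subsetP => u; rewrite !inE => /orP[->//|/andP[-> _]].
by rewrite orbT.
Qed.

Theorem mainTheorem18 (l : nat) (l_gt0 : 0 < l) (l_lt6 : l < 6) :
  ~ exists (G : sgraph) (x y : G),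
      [/\ adj x y,
          staller_start_game_dom G = l &
          staller_start_game_dom (del_edge x y) + 2 = l].
Proof.
case=> G [x [y [_ lenG lenH]]].
have : staller_start_game_dom (del_edge x y) <= l - 2 by rewrite -lenH addnK.
move/staller_start_game_dom_leP; case def_k: (l - 2) => [|k] endsH.
  (* A game of length 0 needs an empty graph, but [x] is a vertex. *)
  by case: endsH => // /setP/(_ (x : del_edge x y)); rewrite !inE.
have def_l : l = k.+3.
  by rewrite -lenH addnK in def_k; rewrite -lenH def_k addn2.
(* After Staller's opening, [k = l - 3] moves remain on [G - e]; this is where [l < 6] enters. *)
have le_k2 : k <= 2 by rewrite def_l in l_lt6.
have endsG : ends_within (@cl_nbhd G) k.+2 Staller set0.
  apply: (Staller_ends_within_super (M := @cl_nbhd (del_edge x y))) => //.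
    exact: (@cl_nbhd_refl (del_edge x y)).
  exact: (@cl_nbhd_del_edge G x y).
by move/staller_start_game_dom_leP: endsG; rewrite lenG def_l ltnn.
Qed.
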